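(* Let $G$ be a pure $\kappa$-sparse gapset with multiplicity $m$. Then $\kappa \leq m$.
   Context: $\mathbb{N}$ denotes the positive integers. A gapset is a finite set $G \subset \mathbb{N}$ such that whenever $z \in G$ and $z = x+y$ with $x,y \in \mathbb{N}$, then $x \in G$ or $y \in G$. The genus of $G$ is its cardinality $g$; we write $G = \{\ell_1 < \ell_2 < \cdots < \ell_g\}$. The multiplicity is $m(G) := \min\{s \in \mathbb{N} : s \notin G\}$. For $g \geq 2$, $G$ is pure $\kappa$-sparse if $\ell_{i+1}-\ell_i \leq \kappa$ for all $i \in \{1,\dots,g-1\}$ and $\ell_{i+1}-\ell_i = \kappa$ for some $i$. By convention, $\emptyset$ is pure $0$-sparse and $\{1\}$ is pure $1$-sparse (and for no other value of the parameter). *)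

(* Defs.v *)
From mathcomp Require Import all_boot.
From mathcomp Require Import finmap.

Set Implicit Arguments.
Unset Strict Implicit.
Unset Printing Implicit Defensive.

Local Open Scope fset_scope.
Local Open Scope nat_scope.

(* The paper's N is the set of positive integers, whence [0 \notin G] and the
   positivity conditions on x and y. *)
Definition gapset (G : {fset nat}) : Prop :=
  0 \notin G /\
  forall x y z : nat, 0 < x -> 0 < y -> z \in G -> z = x + y ->
    x \in G \/ y \in G.

Definition genus (G : {fset nat}) : nat := #|` G|.

(* 0-based: the increasing enumeration of G is
   ell G 0 < ... < ell G (genus G).-1. *)
Definition ell (G : {fset nat}) (i : nat) : nat := nth 0 (sort leq G) i.

Lemma multiplicity_subproof (G : {fset nat}) :
  exists s, (0 < s) && (s \notin G).
Proof.
exists (\max_(x <- G) x).+1; rewrite ltn0Sn /=; apply/negP => sG.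
by have := @leq_bigmax_seq nat _ xpredT id _ sG isT; rewrite ltnn.
Qed.

Definition multiplicity (G : {fset nat}) : nat := ex_minn (multiplicity_subproof G).

(* A gapset of genus 1 is necessarily {1}, so for gapsets the three cases are
   exhaustive.  The truncated subtraction is harmless as ell is increasing. *)
Definition pure_sparse (k : nat) (G : {fset nat}) : Prop :=
  [\/ G = fset0 /\ k = 0,
      G = [fset 1] /\ k = 1
    | [/\ 2 <= genus G,
          forall i, i.+1 < genus G -> ell G i.+1 - ell G i <= k
        & exists2 i, i.+1 < genus G & ell G i.+1 - ell G i = k]].

(* Main.v *)
(** If two consecutive gaps a < b satisfied b - a > m, then b = m + (b - m) with
    m not a gap would make b - m a gap lying strictly between a and b. *)
Require Import Defs.
From mathcomp Require Import all_boot.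
From mathcomp Require Import finmap.

(** Apart from the two conventional cases, [k] is itself a difference b - a of consecutive gaps, so
    it suffices to refute a + m < b. In the splitting b = m + (b - m), the gapset property puts a
    summand in [G]; [multiplicity_notin] excludes m, and [ell_gap] excludes b - m. *)

Lemma size_sort_genus (G : {fset nat}) : size (sort leq G) = genus G.
Proof. by rewrite size_sort. Qed.

Lemma ell_in (G : {fset nat}) (i : nat) : i < genus G -> ell G i \in G.
Proof. by rewrite -size_sort_genus => /(mem_nth 0); rewrite mem_sort. Qed.

Lemma ell_surj (G : {fset nat}) (x : nat) :
  x \in G -> exists2 i, i < genus G & ell G i = x.
Proof.
rewrite -(mem_sort leq) => /(nthP 0) [i]; rewrite size_sort_genus => iG <-.
by exists i.
Qed.

Lemma leq_ell (G : {fset nat}) (i j : nat) :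
  j < genus G -> i <= j -> ell G i <= ell G j.
Proof.
move=> jG ij; apply: (sorted_leq_nth leq_trans leqnn 0 _ i j) => //.
- exact: (sort_sorted leq_total).
- by rewrite inE size_sort_genus (leq_ltn_trans ij).
- by rewrite inE size_sort_genus.
Qed.

(** An element of [G] has some index [j] in the enumeration; by monotonicity, [j <= i] puts it at or
    below [ell G i], and [j > i] at or above [ell G i.+1]. *)
Lemma ell_gap (G : {fset nat}) (i x : nat) :
  i.+1 < genus G -> ell G i < x -> x < ell G i.+1 -> x \notin G.
Proof.
move=> iG ltix ltxi; apply/negP => /ell_surj [j jG ellj].
have [ji|ij] := leqP j i.
  by have := leq_ell G j i (ltnW iG) ji; rewrite ellj leqNgt ltix.
by have := leq_ell G i.+1 j jG ij; rewrite ellj leqNgt ltxi.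
Qed.

Lemma multiplicity_gt0 (G : {fset nat}) : 0 < multiplicity G.
Proof. by rewrite /multiplicity; case: ex_minnP => m /andP[]. Qed.

Lemma multiplicity_notin (G : {fset nat}) : multiplicity G \notin G.
Proof. by rewrite /multiplicity; case: ex_minnP => m /andP[]. Qed.

Theorem proposition3p2 (G : {fset nat}) (k : nat) (hG : gapset G)
  (hk : pure_sparse k G) : k <= multiplicity G.
Proof.
have m_gt0 := multiplicity_gt0 G.
(* The conventional values 0 and 1 of [k] are settled by [m_gt0]. *)
case: hk => [[_ ->]|[_ ->]|[_ _ [i iG <-]]] //.
rewrite leqNgt ltn_subRL; apply/negP => lt_am_b.
have lt_a_bm : ell G i < ell G i.+1 - multiplicity G.
  by rewrite ltn_subRL addnC.
have bmE : ell G i.+1 = multiplicity G + (ell G i.+1 - multiplicity G).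
  by rewrite subnKC // ltnW // (leq_ltn_trans (leq_addl (ell G i) _)).
have lt_bm_b : ell G i.+1 - multiplicity G < ell G i.+1.
  by rewrite {2}bmE -{1}[_ - _]add0n ltn_add2r.
have [||] // := hG.2 _ _ _ m_gt0 _ (ell_in _ _ iG) bmE.
(* The summand b - m is positive because 0 <= a < b - m. *)
- exact: leq_ltn_trans lt_a_bm.
- by rewrite (negbTE (multiplicity_notin G)).
- by rewrite (negbTE (ell_gap _ _ _ iG lt_a_bm lt_bm_b)).
Qed.
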